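(* Let $r\in\mathbb{N}$, $r\ge1$, let $\kappa_1,\dots,\kappa_r$ be non-zero real constants (some or all of which may coincide), and let $(\alpha,\gamma)$ be a pair of real-valued random variables with $\mathbb{P}(\alpha\ne0)=1$. If $\mathbb{E}\{\ln|\alpha|\}\le 0$, then any bounded solution $y:\mathbb{R}\to\mathbb{R}$ of the equation $$\prod_{j=1}^r\left(1+\frac{1}{\kappa_j}\frac{\mathrm{d}}{\mathrm{d}x}\right)y(x)=\mathbb{E}\{y(\alpha(x-\gamma))\},\qquad x\in\mathbb{R},$$ is constant.
   Context: The product on the left-hand side is a composition of (commuting) first-order constant-coefficient differential operators. A bounded solution is a bounded, $r$ times differentiable function $y:\mathbb{R}\to\mathbb{R}$ satisfying the equation at every $x\in\mathbb{R}$. $\mathbb{E}$ denotes expectation with respect to the joint distribution of $(\alpha,\gamma)$, an arbitrary probability measure on $\mathbb{R}^2$ subject to the stated hypotheses. The condition $\mathbb{E}\{\ln|\alpha|\}\le 0$ means that this expectation is well defined (the value $-\infty$ being allowed) and is at most $0$. The case $|\alpha|=1$ almost surely is included. *)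

(* Defs.v *)
From HB Require Import structures.
From mathcomp Require Import all_boot all_order all_algebra.
From mathcomp Require Import all_classical all_reals all_analysis.

Set Implicit Arguments.
Unset Strict Implicit.
Unset Printing Implicit Defensive.

Import Order.TTheory GRing.Theory Num.Theory.
Import numFieldNormedType.Exports.

Local Open Scope classical_set_scope.
Local Open Scope ring_scope.

Definition times_differentiable (R : realType) (r : nat) (y : R -> R) : Prop :=
  forall k : nat, (k < r)%N -> forall x : R, derivable (derive1n k y) x 1.

Definition diffop (R : realType) (kappa : R) (y : R -> R) : R -> R :=
  fun x => y x + kappa^-1 * derive1 y x.

(* The product of operators is their composition. The library derivative is
   total, but on an r times differentiable function each of the r successive
   factors is applied to a genuinely differentiable function. *)
Definition diffop_prod (R : realType) (r : nat) (kappa : 'I_r -> R) :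
    (R -> R) -> (R -> R) :=
  \big[(fun A B : (R -> R) -> (R -> R) => A \o B)/id]_(j < r) diffop (kappa j).

(* The library integral assigns the value -oo to +oo - +oo; [+?] excludes this
   case, so that the expectation exists in the extended reals. *)
Definition expectation_well_defined d (T : measurableType d) (R : realType)
    (P : probability T R) (X : T -> R) : Prop :=
  ((\int[P]_w (EFin \o X)^\+ w) +? (- \int[P]_w (EFin \o X)^\- w))%E.

Definition bounded_solution d (T : measurableType d) (R : realType)
    (P : probability T R) (r : nat) (kappa : 'I_r -> R)
    (alpha gamma : T -> R) (y : R -> R) : Prop :=
  [/\ bounded_fun y, times_differentiable r y &
    forall x : R, ((diffop_prod kappa y x)%:E =
      'E_P[fun w => (y (alpha w * (x - gamma w)))%R])%E ].

(* Main.v *)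
Require Import Defs.
From HB Require Import structures.
From mathcomp Require Import all_boot all_order all_algebra.
From mathcomp Require Import all_classical all_reals all_analysis.
From mathcomp Require Import measurable_realfun ring lra.

Set Implicit Arguments.
Unset Strict Implicit.
Unset Printing Implicit Defensive.

Import Order.TTheory GRing.Theory Num.Theory.
Import numFieldNormedType.Exports.

Local Open Scope classical_set_scope.
Local Open Scope ring_scope.

(* Let v be y acted on by all factors but the outermost. A bounded function u with
   |prod_j (1 + D/kappa_j) u| <= C satisfies |u| <= C, so boundedness passes to v,
   v is Lipschitz, and then so is y. Put xi = ln|alpha| and let M(t) be the modulus
   of continuity of y at scale e^t. Applying the same estimate to the increments of
   y gives M(t) <= E M(t + xi).

   For a bounded nondecreasing M, integrating E[M(t + xi)^2 - M(t)^2] over t in R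
   gives (M(+oo)^2 - M(-oo)^2) E xi <= 0, whereas by subharmonicity the integrand
   dominates E(M(t + xi) - M(t))^2 >= 0. Hence M(t + xi) = M(t) almost everywhere,
   so that either xi = 0 almost surely, or M is constant, equal to M(-oo) = 0.

   If |alpha| = 1 almost surely, let S = sup |v(. + h) - v|. The right-hand side has
   increments at most S, so an increment of v close to S at x forces increments close
   to S at x + h, x + 2h, ... (or x - h, x - 2h, ...). These telescope, and v is
   bounded, so S = 0. *)

(** * Comparison principle and bounds for a single factor 1 + D/k *)

Section first_order_factor.
Context {R : realType}.
Implicit Types (k x t C : R) (v w y : R -> R).

(** The derivative of s |-> e^(-s) w(x - s/k) is -e^(-s) (w + w'/k)(x - s/k) <= 0. The comparison
    thus runs in the direction of -1/k, whatever the sign of k. *)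
Lemma diffop_ge0_le k w x t : k != 0 -> 0 <= t ->
  (forall z : R, derivable w z 1) ->
  (forall s : R, 0 <= s <= t -> 0 <= diffop k w (x - s / k)) ->
  w (x - t / k) <= expR t * w x.
Proof.
move=> k0 t0 dw Aw.
pose phi (s : R) : R := expR (- s) * w (x - s / k).
have dphi (s : R) : is_derive s 1 phi (- expR (- s) * diffop k w (x - s / k)).
  have dW : is_derive (x - s / k) 1 w (derive1 w (x - s / k)).
    by rewrite derive1E; exact/derivableP.
  have dE : is_derive s 1 (fun s : R => expR (- s)) (- expR (- s)).
    by apply: is_derive_eq; rewrite /GRing.scale /=; ring.
  have dL : is_derive s 1 (fun s : R => x - s / k) (- k^-1).
    by apply: is_derive_eq; rewrite /GRing.scale /=; ring.
  have dWL := @is_derive1_comp _ w (fun s : R => x - s / k) s _ _ dW dL.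
  apply: is_derive_eq.
  by rewrite /diffop /GRing.scale /=; field.
have cphi : {within `[0, t], continuous phi}.
  apply: derivable_within_continuous => s _.
  by case: (dphi s).
have le_phi : phi t <= phi 0.
  apply: (@ler0_derive1_le_cc _ phi 0 t) => //.
  - move=> s; rewrite in_itv/= => /andP[s0 st].
    by rewrite derive1E (@derive_val _ _ _ _ _ _ _ (dphi s)) mulNr oppr_le0 mulr_ge0 ?expR_ge0//
     Aw// (ltW s0) ltW.
  - by rewrite in_itv/= lexx t0.
  - by rewrite in_itv/= lexx t0.
move: le_phi; rewrite /phi oppr0 expR0 mul1r mul0r subr0 expRN.
by rewrite ler_pdivrMl ?expR_gt0.
Qed.


Lemma diffop_affine k (a C : R) v x : derivable v x 1 ->
  diffop k (fun z => a * v z - C) x = a * diffop k v x - C.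
Proof.
move=> dv; rewrite /diffop derive1E.
have dV : is_derive x 1 v (derive1 v x) by rewrite derive1E; exact/derivableP.
have dW : is_derive x 1 (fun z => a * v z - C) (a * derive1 v x).
  apply: is_derive_eq.
  by rewrite /GRing.scale /=; ring.
by rewrite (@derive_val _ _ _ _ _ _ _ (dW)); ring.
Qed.

Lemma derivable_affine (a C : R) v x : derivable v x 1 ->
  derivable (fun z => a * v z - C) x 1.
Proof.
move=> dv.
have dV : is_derive x 1 v (derive1 v x) by rewrite derive1E; exact/derivableP.
have dW : is_derive x 1 (fun z => a * v z - C) (a * derive1 v x).
  apply: is_derive_eq.
  by rewrite /GRing.scale /=; ring.
by case: dW.
Qed.

(* |u| is unbounded along the ray of direction [s], with a fixed sign: [e * u]
   tends to +oo there. *)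
Definition escapes (s : R) (u : R -> R) : Prop :=
  exists e : R, forall C, exists X : R, forall x, X <= x -> C <= e * u (s * x).

Lemma bounded_not_escapes (s B : R) u : (forall x, `|u x| <= B) ->
  ~ escapes s u.
Proof.
move=> uB [e /(_ (`|e| * B + 1))[X /(_ X (lexx _))]].
apply/negP; rewrite -ltNge.
have := ler_norm (e * u (s * X)); rewrite normrM.
have := ler_wpM2l (normr_ge0 e) (uB (s * X)).
lra.
Qed.

(** Partial products applied to y are not known in advance to be bounded; read contrapositively,
    this passes non-escape from y to all of them. The sign [e] may change on the way. *)
Lemma escapes_diffop k s v : k != 0 -> s != 0 ->
  (forall x : R, derivable v x 1) -> escapes s (diffop k v) -> escapes s v.
Proof.
move=> k0 s0 dv [e He].
have ks0 : k * s != 0 by rewrite mulf_neq0.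
have dw C : forall x : R, derivable (fun z => e * v z - C) x 1.
  by move=> x; exact: derivable_affine.
have [ks|ks] : 0 < k * s \/ 0 < - (k * s).
    by case: (ltgtP (k * s) 0) ks0 => [h|h|->]; rewrite ?eqxx// => _;
      [right; rewrite oppr_gt0|left].
(* For k s > 0 the comparison leads from s x back to s X: a value w(s x) < -1 would give w(s X) <
   -e^t, impossible once t >= |w(s X)|. *)
- exists e => C; have [X HX] := He (C + 1).
  pose w z := e * v z - (C + 1).
  exists (X + `|w (s * X)| / (k * s)) => x Xx.
  pose t := k * s * (x - X).
  have wt : `|w (s * X)| <= t.
    by rewrite /t [leRHS]mulrC -ler_pdivrMr//; rewrite lerBrDl.
  have t0 : 0 <= t by exact: le_trans wt.
  have := @diffop_ge0_le k w (s * x) t k0 t0 (dw _).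
  have -> : s * x - t / k = s * X by rewrite /t; field.
  have Aw : forall s0 : R, 0 <= s0 <= t -> 0 <= diffop k w (s * x - s0 / k).
    move=> s1 /andP[s10 s1t].
    rewrite diffop_affine//.
    have -> : s * x - s1 / k = s * (x - s1 / (k * s)) by field; apply/andP.
    rewrite subr_ge0; apply: HX.
    have : s1 / (k * s) <= x - X by rewrite ler_pdivrMr// mulrC.
    by set d := s1 / _; lra.
  move=> /(_ Aw) h.
  rewrite leNgt; apply/negP => Cv.
  have w1 : w (s * x) < -1 by rewrite /w; lra.
  have et : 1 + t <= expR t by exact: expR_ge1Dx.
  have := ler_norm (- w (s * X)); rewrite normrN.
  nra.
(* Now the weight e^{kz} decays towards the ray: either [e * v] falls below some
   bound on [e * diffop k v], and then it is driven to -oo exponentially fast,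
   or it stays above all of them. *)
have [[C [X [x [HX Xx xC]]]]|nex] := pselect (exists C X x : R,
    [/\ forall z, X <= z -> C <= e * diffop k v (s * z), X <= x &
        e * v (s * x) < C]); last first.
  exists e => C; have [X HX] := He C; exists X => x Xx.
  by rewrite leNgt; apply/negP => xC; apply: nex; exists C, X, x.
exists (- e) => C'.
pose w z := e * v z - C.
have wx : 0 < - w (s * x) by rewrite /w; lra.
exists (x + `|C + C'| / (- w (s * x)) / (- (k * s))) => x' xx'.
pose t := - (k * s) * (x' - x).
have tC : `|C + C'| / (- w (s * x)) <= t.
  by rewrite /t [leRHS]mulrC -ler_pdivrMr// lerBrDl.
have t0 : 0 <= t by apply: le_trans tC; rewrite divr_ge0// ltW.
have := @diffop_ge0_le k w (s * x) t k0 t0 (dw _).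
have -> : s * x - t / k = s * x' by rewrite /t; field.
have Aw : forall s0 : R, 0 <= s0 <= t -> 0 <= diffop k w (s * x - s0 / k).
  move=> s1 /andP[s10 s1t].
  rewrite diffop_affine//.
  have -> : s * x - s1 / k = s * (x + s1 / (- (k * s))) by field; apply/andP.
  rewrite subr_ge0; apply: HX.
  have : 0 <= s1 / (- (k * s)) by rewrite divr_ge0// ltW.
  lra.
move=> /(_ Aw) h.
have et : 1 + t <= expR t by exact: expR_ge1Dx.
move: tC; rewrite ler_pdivrMr// => tC.
have := ler_norm (C + C').
move: h tC wx; rewrite {1}/w; set W := w _; nra.
Qed.

(** If a v(x) > C with a = 1 or -1, then w = C - a v is negative at x and w + w'/k >= 0 everywhere,
    so w is driven to -oo exponentially fast along the ray of direction -1/k, and v escapes. *)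
Lemma diffop_bound k C v : k != 0 -> (forall x : R, derivable v x 1) ->
  (forall s : R, s != 0 -> ~ escapes s v) ->
  (forall x, `|diffop k v x| <= C) -> forall x, `|v x| <= C.
Proof.
move=> k0 dv nesc Av x.
suff H (a : R) : `|a| = 1 -> a * v x <= C.
  rewrite ler_norml; have := H 1 (normr1 _); have := H (-1) (normrN1 _).
  by rewrite mulN1r mul1r; lra.
move=> a1; rewrite leNgt; apply/negP => Cx.
apply: (nesc (- k^-1)); first by rewrite oppr_eq0 invr_eq0.
exists a => C'.
pose w z := - a * v z - (- C).
have wx : 0 < - w x by rewrite /w; lra.
(* With t = k x + z the point x - t/k is -z/k, and the bound e^t >= 1 + t is enough to push a v
   beyond C'. *)
exists (`|C' - C| / (- w x) - k * x + `|k * x|) => z zX.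
pose t := k * x + z.
have tC : `|C' - C| / (- w x) <= t.
  by move: zX; rewrite /t; have := normr_ge0 (k * x); lra.
have t0 : 0 <= t by apply: le_trans tC; rewrite divr_ge0// ltW.
have := @diffop_ge0_le k w x t k0 t0.
have -> : x - t / k = - k^-1 * z by rewrite /t; field.
have dw : forall z : R, derivable w z 1 by move=> ?; exact: derivable_affine.
move=> /(_ dw) h.
have {}h : w (- k^-1 * z) <= expR t * w x.
  apply: h => s _; rewrite diffop_affine//.
  have := ler_norm (a * diffop k v (x - s / k)); rewrite normrM a1 mul1r.
  have := Av (x - s / k); lra.
have et : 1 + t <= expR t by exact: expR_ge1Dx.
move: tC; rewrite ler_pdivrMr// => tC.
have := ler_norm (C' - C).
move: h tC wx; rewrite {1}/w; set W := w _; nra.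
Qed.

End first_order_factor.

(** * Products of factors: differentiability, bounds, and commutation with increments *)

Section diffop_product.
Context {R : realType}.
Implicit Types (v u y : R -> R).

Lemma diffop_prodS n (kappa : 'I_n.+1 -> R) y :
  diffop_prod kappa y =
  diffop (kappa ord0) (diffop_prod (fun i => kappa (lift ord0 i)) y).
Proof. by rewrite /diffop_prod big_ord_recl. Qed.

Lemma times_differentiableW m n y : (m <= n)%N ->
  times_differentiable n y -> times_differentiable m y.
Proof. by move=> mn dy k km; apply: dy; exact: leq_trans mn. Qed.

Lemma derive1n_diffop n k v j : times_differentiable n.+1 v -> (j <= n)%N ->
  derive1n j (diffop k v) = diffop k (derive1n j v).
Proof.
move=> dv; elim: j => [//|j IH jn].
rewrite derive1nS IH ?(ltnW jn)//; apply/funext => x.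
have dj : is_derive x 1 (derive1n j v) (derive1n j.+1 v x).
  by rewrite derive1nS derive1E; apply/derivableP/dv; rewrite ltnS ltnW.
have djS : is_derive x 1 (derive1 (derive1n j v)) (derive1n j.+2 v x).
  by rewrite -derive1nS [derive1n j.+2 v]derive1nS derive1E; exact/derivableP/dv.
have dW : is_derive x 1 (diffop k (derive1n j v))
    (diffop k (derive1n j.+1 v) x).
  by rewrite /diffop; apply: is_derive_eq.
by rewrite derive1E (@derive_val _ _ _ _ _ _ _ dW).
Qed.

Lemma times_differentiable_diffop n k v :
  times_differentiable n.+1 v -> times_differentiable n (diffop k v).
Proof.
move=> dv j jn x; rewrite (derive1n_diffop _ dv) ?(ltnW jn)//.
have dj : derivable (derive1n j v) x 1 by apply: dv; rewrite ltnS ltnW.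
have djS : derivable (derive1 (derive1n j v)) x 1.
  by rewrite -derive1nS; exact: dv.
by apply: derivableD => //; apply: derivableZ.
Qed.

Lemma times_differentiable_diffop_prod n m (kappa : 'I_n -> R) y :
  times_differentiable (n + m) y -> times_differentiable m (diffop_prod kappa y).
Proof.
elim: n m kappa => [|n IH] m kappa dy; first by rewrite /diffop_prod big_ord0.
rewrite diffop_prodS; apply: times_differentiable_diffop; apply: IH.
by rewrite addnS -addSn.
Qed.

Lemma derivable_diffop_prod n (kappa : 'I_n -> R) y x :
  times_differentiable n.+1 y -> derivable (diffop_prod kappa y) x 1.
Proof.
move=> dy.
have : times_differentiable 1 (diffop_prod kappa y).
  by apply: times_differentiable_diffop_prod; rewrite addn1.
by move=> /(_ 0%N isT x).
Qed.

Lemma escapes_diffop_prod n (kappa : 'I_n -> R) (s : R) y : s != 0 ->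
  (forall i, kappa i != 0) -> times_differentiable n y ->
  escapes s (diffop_prod kappa y) -> escapes s y.
Proof.
move=> s0; elim: n kappa => [|n IH] kappa k0 dy.
  by rewrite /diffop_prod big_ord0.
rewrite diffop_prodS => /escapes_diffop esc.
apply: (IH (fun i => kappa (lift ord0 i))) => //.
  exact: times_differentiableW dy.
by apply: esc => // x; exact: derivable_diffop_prod.
Qed.

(** The factors are peeled off from the outermost inwards, each keeping the bound C. The bound B
    only rules out escape of the partial products and does not enter the conclusion. *)
Lemma diffop_prod_bound n (kappa : 'I_n -> R) (B C : R) y :
  (forall i, kappa i != 0) -> times_differentiable n y ->
  (forall x, `|y x| <= B) -> (forall x, `|diffop_prod kappa y x| <= C) ->
  forall x, `|y x| <= C.
Proof.
move=> + + yB; elim: n kappa => [|n IH] kappa k0 dy.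
  by rewrite /diffop_prod big_ord0.
rewrite diffop_prodS => /diffop_bound bnd.
apply: (IH (fun i => kappa (lift ord0 i))) => //.
  exact: times_differentiableW dy.
apply: bnd => //; first by move=> x; exact: derivable_diffop_prod.
move=> s s0 /escapes_diffop_prod esc.
apply: (@bounded_not_escapes R s B y yB); apply: esc => //.
exact: times_differentiableW dy.
Qed.

Definition incr (h : R) y : R -> R := fun x => y (x + h) - y x.

Lemma is_derive_incr (h : R) y (x : R) : (forall z : R, derivable y z 1) ->
  is_derive x 1 (incr h y) (incr h (derive1 y) x).
Proof.
move=> dy.
have d0 (z : R) : is_derive z 1 y (derive1 y z).
  by rewrite derive1E; exact/derivableP.
have dL : is_derive x 1 (fun z : R => z + h) 1.
  by apply: is_derive_eq; rewrite addr0.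
have dC := @is_derive1_comp _ y (fun z : R => z + h) x _ _ (d0 _) dL.
apply: (@is_derive_eq _ _ _ _ _ _ _ _ (is_deriveB dC (d0 x))).
by rewrite mulr1.
Qed.

Lemma derive1_incr h y : (forall z : R, derivable y z 1) ->
  derive1 (incr h y) = incr h (derive1 y).
Proof.
move=> dy; apply/funext => x.
by rewrite derive1E (@derive_val _ _ _ _ _ _ _ (is_derive_incr h x dy)).
Qed.

Lemma derive1n_incr h n y : times_differentiable n y ->
  derive1n n (incr h y) = incr h (derive1n n y).
Proof.
elim: n => [//|n IH] dy; rewrite derive1nS IH.
  by rewrite derive1_incr//; exact: dy.
exact: times_differentiableW dy.
Qed.

Lemma times_differentiable_incr h n y :
  times_differentiable n y -> times_differentiable n (incr h y).
Proof.
move=> dy k kn x; rewrite derive1n_incr; last exact: times_differentiableW (ltnW kn) dy.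
by case: (@is_derive_incr h (derive1n k y) x (dy k kn)).
Qed.

Lemma diffop_incr k h v : (forall z : R, derivable v z 1) ->
  diffop k (incr h v) = incr h (diffop k v).
Proof.
move=> dv; apply/funext => x.
by rewrite /diffop derive1_incr// /incr; ring.
Qed.

Lemma diffop_prod_incr h n (kappa : 'I_n -> R) y : times_differentiable n y ->
  diffop_prod kappa (incr h y) = incr h (diffop_prod kappa y).
Proof.
elim: n kappa => [|n IH] kappa dy; first by rewrite /diffop_prod !big_ord0.
rewrite !diffop_prodS IH; last exact: times_differentiableW dy.
by rewrite diffop_incr// => x; exact: derivable_diffop_prod.
Qed.

End diffop_product.

(** * Integrals of increments as Stieltjes masses *)

Section stieltjes_increments.
Context {R : realType}.
Local Open Scope ereal_scope.

Lemma lebesgue_stieltjes_itv (f : cumulative R R) (a b : R) : (a <= b)%R ->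
  lebesgue_stieltjes_measure f `]a, b]%classic = (f b - f a)%:E.
Proof.
move=> ab; rewrite /lebesgue_stieltjes_measure /measure_extension.
rewrite measurable_mu_extE/=; last exact: is_ocitv.
by rewrite wlength_itv_bnd// EFinB.
Qed.

Lemma lebesgue_stieltjes_setT_le (f : cumulative R R) (B : R) :
  (forall a b, f b - f a <= B)%R -> lebesgue_stieltjes_measure f setT <= B%:E.
Proof.
move=> fB; rewrite -(bigcup_itvT false false).
pose I (n : nat) : set R := `](- n%:R)%R, (n%:R)%R]%classic.
have : (lebesgue_stieltjes_measure f \o I) n @[n --> \oo] -->
    lebesgue_stieltjes_measure f (\bigcup_n I n).
  apply: nondecreasing_cvg_mu; rewrite /I//; first exact: bigcup_measurable.
  by move=> *; apply/subsetPset/subset_itv; rewrite leBSide/= ?lerN2 ler_nat.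
move=> cvgI; rewrite -(cvg_lim _ cvgI)//.
apply: lime_le; first by apply/cvg_ex; exists (lebesgue_stieltjes_measure f (\bigcup_n I n)).
by apply: nearW => n /=; rewrite lebesgue_stieltjes_itv ?ge0_cp// lee_fin.
Qed.

Lemma integral_increment (f : cumulative R R) (a b : R) : (a <= b)%R ->
  \int[lebesgue_measure]_t (f (t + b) - f (t + a))%:E =
  (b - a)%:E * lebesgue_stieltjes_measure f setT.
Proof.
(* f (t + b) - f (t + a) is the Stieltjes mass of the u with t + a < u <= t + b,
   and for fixed u these t form an interval of length b - a. *)
move=> ab.
pose A : set (measurableTypeR R * measurableTypeR R) :=
  [set z | (z.1 + a < z.2) && (z.2 <= z.1 + b)]%R.
have mA : measurable A.
  rewrite (_ : A = (fun z : measurableTypeR R * measurableTypeR R =>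
      (z.1 + a < z.2) && (z.2 <= z.1 + b))%R @^-1` [set true]); last first.
    by apply/seteqP; split.
  rewrite -[X in measurable X]setTI; apply: measurable_and => //.
  - by apply: measurable_fun_ltr => //; exact: measurable_funD.
  - by apply: measurable_fun_ler => //; exact: measurable_funD.
pose mu := lebesgue_stieltjes_measure f.
have := @indic_fubini_tonelli _ _ _ _ R lebesgue_measure mu A mA.
rewrite (indic_fubini_tonelli_FE mu mA) (indic_fubini_tonelli_GE lebesgue_measure mA).
under eq_integral => t _.
  rewrite /= (_ : xsection A t = `](t + a)%R, (t + b)%R]%classic); last first.
    by apply/seteqP; split => u; rewrite /xsection /= inE /A /= in_itv.
  rewrite lebesgue_stieltjes_itv ?lerD2l//.
  over.
move=> ->.
under eq_integral => u _.
  rewrite /= (_ : ysection A u = `[(u - b)%R, (u - a)%R[%classic); last first.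
    apply/seteqP; split => t; rewrite /ysection /= inE /A /= in_itv/=.
      by move=> /andP[? ?]; apply/andP; split; lra.
    by move=> /andP[? ?]; apply/andP; split; lra.
  rewrite lebesgue_measure_itv/= lte_fin.
  (* An empty interval occurs only for a = b, where its length 0 is still b - a. *)
  rewrite (_ : (if _ then _ else _) = (b - a)%:E); last first.
    case: ifPn => [_|]; first by rewrite -EFinB; congr EFin; lra.
    rewrite -leNgt => h; congr EFin; lra.
  over.
by rewrite integral_cst.
Qed.

End stieltjes_increments.

(** * Rigidity of bounded monotone subharmonic functions *)

Section rigidity.
Context {R : realType} d (T : measurableType d) (P : probability T R).
Local Open Scope ereal_scope.

Lemma subharmonic_rigidity (xi : T -> R) (M : R -> R) (B : R) :
  measurable_fun setT xi -> {homo M : s t / (s <= t)%R} -> continuous M ->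
  (forall t, 0 <= M t <= B)%R ->
  (forall t, (M t)%:E <= \int[P]_w (M (t + xi w)%R)%:E) ->
  \int[P]_w (EFin \o xi)^\+ w < +oo ->
  \int[P]_w (EFin \o xi)^\+ w <= \int[P]_w (EFin \o xi)^\- w ->
  (forall s t, M s = M t) \/ {ae P, forall w, xi w = 0%R}.
Proof.
move=> mxi ndM cM MB subM Efin Ele.
pose g t : R := (M t * M t)%R.
have M0 t : (0 <= M t)%R by case/andP: (MB t).
have g_nd : nondecreasing g.
  by move=> s t st; rewrite /g ler_pM ?ndM.
have cg : continuous g.
  by move=> t; apply: cvgM; exact: cM.
have g_rc : right_continuous g.
  by move=> t; apply: cvg_at_right_filter; exact: cg.
pose f : cumulative R R := HB.pack g (isCumulative.Build R _ R g g_nd g_rc).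
pose c := lebesgue_stieltjes_measure f setT.
have c0 : 0 <= c by exact: measure_ge0.
have cfin : c < +oo.
  apply: (@le_lt_trans _ _ (B ^+ 2)%:E); last exact: ltry.
  apply: lebesgue_stieltjes_setT_le => a b.
  have := MB a; have := MB b; rewrite /f/= /g => /andP[? ?] /andP[? ?]; nra.
have mM : measurable_fun setT M by exact: continuous_measurable_fun.
have mg : measurable_fun setT g by exact: continuous_measurable_fun.
pose E := (measurableTypeR R * T)%type.
(* The positive and negative parts of xi are treated apart, so that every integrand is nonnegative
   and Tonelli applies even if E xi = -oo. The shifts by 0 match the form of
   [integral_increment]. *)
pose qp (z : E) : R := (g (z.1 + Num.max (xi z.2) 0) - g (z.1 + 0))%R.
pose qn (z : E) : R := (g (z.1 + 0) - g (z.1 + Num.min (xi z.2) 0))%R.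
pose V (z : E) : R := ((M (z.1 + xi z.2) - M z.1) ^+ 2)%R.
have m1 : measurable_fun [set: E] (fun z : E => z.1 : R) by exact: measurable_fst.
have m2 : measurable_fun [set: E] (fun z : E => xi z.2).
  by apply: measurableT_comp => //; exact: measurable_snd.
have mqp : measurable_fun setT qp.
  apply: measurable_funB; apply: measurableT_comp => //; apply: measurable_funD => //.
  exact: measurable_maxr.
have mqn : measurable_fun setT qn.
  apply: measurable_funB; apply: measurableT_comp => //; apply: measurable_funD => //.
  exact: measurable_minr.
have mV : measurable_fun setT V.
  apply: measurable_funX; apply: measurable_funB; apply: measurableT_comp => //.
  exact: measurable_funD.
have qp0 z : (0 <= qp z)%R.
  by rewrite subr_ge0; apply/g_nd; rewrite lerD2l le_max lexx orbT.
have qn0 z : (0 <= qn z)%R.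
  by rewrite subr_ge0; apply/g_nd; rewrite lerD2l ge_min lexx orbT.
have V0 z : (0 <= V z)%R by exact: sqr_ge0.
have posE : \int[P]_w (EFin \o xi)^\+ w = \int[P]_w (Num.max (xi w) 0 - 0)%:E.
  by apply: eq_integral => w _; rewrite subr0 funeposE /= EFin_max.
have negE : \int[P]_w (EFin \o xi)^\- w = \int[P]_w (0 - Num.min (xi w) 0)%:E.
  by apply: eq_integral => w _; rewrite sub0r oppr_min oppr0 funenegE /= EFin_max.
rewrite posE negE {posE negE} in Efin Ele.
pose L := @lebesgue_measure R.
pose pos w := (Num.max (xi w) 0 - 0)%R.
pose neg w := (0 - Num.min (xi w) 0)%R.
have pos0 w : (0 <= pos w)%R by rewrite /pos subr0 le_max lexx orbT.
have neg0 w : (0 <= neg w)%R by rewrite /neg sub0r oppr_ge0 ge_min lexx orbT.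
have mpos : measurable_fun setT (EFin \o pos).
  by apply/measurable_EFinP; apply: measurable_funB => //; exact: measurable_maxr.
have mneg : measurable_fun setT (EFin \o neg).
  by apply/measurable_EFinP; apply: measurable_funB => //; exact: measurable_minr.
have intqp : \int[L \x P]_z (qp z)%:E = \int[P]_w (pos w)%:E * c.
  rewrite (@fubini_tonelli2 _ _ _ _ _ L P (EFin \o qp)); first last.
  - by move=> z; rewrite lee_fin.
  - exact/measurable_EFinP.
  rewrite -ge0_integralZr//; last by move=> w _; rewrite lee_fin.
  apply: eq_integral => w _; rewrite /fubini_G /=.
  rewrite (_ : (fun _ => _) = fun t => (f (t + Num.max (xi w) 0) - f (t + 0))%:E)//.
  by rewrite integral_increment// le_max lexx orbT.
have intqn : \int[L \x P]_z (qn z)%:E = \int[P]_w (neg w)%:E * c.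
  rewrite (@fubini_tonelli2 _ _ _ _ _ L P (EFin \o qn)); first last.
  - by move=> z; rewrite lee_fin.
  - exact/measurable_EFinP.
  rewrite -ge0_integralZr//; last by move=> w _; rewrite lee_fin.
  apply: eq_integral => w _; rewrite /fubini_G /=.
  rewrite (_ : (fun _ => _) = fun t => (f (t + 0) - f (t + Num.min (xi w) 0))%:E)//.
  by rewrite integral_increment// ge_min lexx orbT.
(* (M(t + xi) - M t)^2 = g(t + xi) - g t - 2 M t (M(t + xi) - M t), and the
   last term has nonpositive mean by subharmonicity. *)
have slice (t : measurableTypeR R) :
    \int[P]_w (qn (t, w) + V (t, w))%R%:E <= \int[P]_w (qp (t, w))%:E.
  have mMt : measurable_fun setT (fun w => M (t + xi w)%R).
    by apply: measurableT_comp => //; exact: measurable_funD.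
  have mpt (h : E -> R) : measurable_fun setT h -> measurable_fun setT (fun w => (h (t, w))%:E).
    by move=> mh; apply/measurable_EFinP; apply: measurableT_comp.
  have iM : (2 * M t * M t)%R%:E <= \int[P]_w (2 * M t * M (t + xi w))%R%:E.
    under eq_integral do rewrite EFinM.
    rewrite ge0_integralZl_EFin//.
    - by rewrite EFinM; apply: lee_wpmul2l => //; rewrite lee_fin mulr_ge0.
    - by move=> w _; rewrite lee_fin.
    - exact/measurable_EFinP.
    - by rewrite mulr_ge0.
  (* The identity is arranged without subtractions: qn + V + 2 M(t) M(t + xi) = qp + 2 M(t)^2, all
     terms being nonnegative. *)
  have split : \int[P]_w (qn (t, w) + V (t, w))%R%:E +
      \int[P]_w (2 * M t * M (t + xi w))%R%:E =
      \int[P]_w (qp (t, w))%:E + (2 * M t * M t)%R%:E.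
    rewrite -(mule1 (2 * M t * M t)%R%:E) -(probability_setT P).
    rewrite -(@integral_cst _ _ _ P)// -!ge0_integralD//.
    - apply: eq_integral => w _; rewrite -!EFinD; congr EFin.
      rewrite /qn /qp /V /g /= !addr0.
      by case: (leP (xi w) 0%R) => _; rewrite !addr0; ring.
    - by move=> w _; rewrite lee_fin.
    - exact: mpt.
    - by move=> w _; rewrite /cst lee_fin !mulr_ge0.
    - by move=> w _; rewrite lee_fin addr_ge0.
    - by apply: (mpt (fun z => qn z + V z)%R); exact: measurable_funD.
    - by move=> w _; rewrite lee_fin !mulr_ge0.
    - by apply/measurable_EFinP; exact: measurable_funM.
  rewrite -(@leeD2rE _ (2 * M t * M t)%R%:E)// -split.
  exact: leeD2l.
have intV : \int[L \x P]_z (qn z)%:E + \int[L \x P]_z (V z)%:E <=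
    \int[L \x P]_z (qp z)%:E.
  have mqnV : measurable_fun setT (fun z => (qn z + V z)%R%:E).
    by apply/measurable_EFinP; exact: measurable_funD.
  rewrite -ge0_integralD//; [|by move=> z _; rewrite lee_fin|
    exact/measurable_EFinP|by move=> z _; rewrite lee_fin|exact/measurable_EFinP].
  under eq_integral do rewrite -EFinD.
  rewrite (@fubini_tonelli1 _ _ _ _ _ L P (EFin \o qp)); first last.
  - by move=> z; rewrite lee_fin.
  - exact/measurable_EFinP.
  rewrite (@fubini_tonelli1 _ _ _ _ _ L P (fun z => (qn z + V z)%R%:E)) //; last first.
    by move=> z; rewrite lee_fin addr_ge0.
  apply: ge0_le_integral => //.
  - by move=> t _; apply: integral_ge0 => w _; rewrite lee_fin addr_ge0.
  - by apply: measurable_fun_fubini_tonelli_F => // z; rewrite lee_fin addr_ge0.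
  - apply: measurable_fun_fubini_tonelli_F; first exact/measurable_EFinP.
    by move=> z; rewrite lee_fin.
  - by move=> t _; exact: slice.
have Ep_fin : \int[P]_w (pos w)%:E * c \is a fin_num.
  rewrite fin_numM// ge0_fin_numE//.
  by apply: integral_ge0 => w _; rewrite lee_fin.
(* c E xi^+ + int V <= c E xi^- + int V <= c E xi^+, and c E xi^+ is finite, so it cancels. *)
have V_0 : \int[L \x P]_z (V z)%:E = 0.
  apply/eqP; rewrite eq_le; apply/andP; split; last first.
    by apply: integral_ge0 => z _; rewrite lee_fin.
  rewrite -(@leeD2lE _ (\int[P]_w (pos w)%:E * c))// adde0.
  rewrite -{2}intqp (le_trans _ intV)// leeD2r// intqn.
  exact: lee_wpmul2r.
(* V vanishes almost everywhere, and [qp] and [qn] vanish wherever V does; hence c E xi^+ = c E xi^-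
   = 0. *)
have zero_of_V (q : E -> R) : measurable_fun setT q ->
    (forall z, (0 <= q z)%R) -> (forall z, V z = 0%R -> q z = 0%R) ->
    \int[L \x P]_z (q z)%:E = 0.
  move=> mq q0 qV.
  under eq_integral => z _ do rewrite -[(q z)%:E]gee0_abs ?lee_fin//.
  apply/ae_eq_integral_abs => //; first exact/measurable_EFinP.
  have : ae_eq (L \x P) setT (EFin \o V) (cst 0).
    apply/ae_eq_integral_abs => //; first exact/measurable_EFinP.
    rewrite -[RHS]V_0; apply: eq_integral => z _.
    by rewrite gee0_abs ?lee_fin.
  apply: filterS => z /= + zT => /(_ zT) [Vz]; congr EFin; exact: qV.
have VM z : V z = 0%R -> M (z.1 + xi z.2)%R = M z.1.
  by move/eqP; rewrite /V sqrf_eq0 subr_eq0 => /eqP.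
have qp_0 : \int[L \x P]_z (qp z)%:E = 0.
  apply: zero_of_V => // z /VM Vz; rewrite /qp /g addr0.
  by case: (leP (xi z.2) 0%R) => _; rewrite ?addr0 ?Vz subrr.
have qn_0 : \int[L \x P]_z (qn z)%:E = 0.
  apply: zero_of_V => // z /VM Vz; rewrite /qn /g addr0.
  by case: (leP (xi z.2) 0%R) => _; rewrite ?addr0 ?Vz subrr.
(* If c = 0, then g = M^2 is constant and so is M >= 0; otherwise both parts of xi have mean 0. *)
have [c_0|c_neq0] := eqVneq c 0.
  left; have H s t : (s <= t)%R -> g s = g t.
    move=> st.
    have : lebesgue_stieltjes_measure f `]s, t]%classic = 0.
      apply/eqP; rewrite -measure_le0 -c_0; apply: le_measure => //.
      by rewrite inE.
      by rewrite inE.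
    rewrite lebesgue_stieltjes_itv// => -[] /eqP.
    by rewrite subr_eq0 => /eqP.
  move=> s t.
  have : g s = g t by case: (leP s t) => [|/ltW] /H.
  rewrite /g -!expr2 => /(congr1 Num.sqrt).
  by rewrite !sqrtr_sqr !ger0_norm.
right.
have aepos : ae_eq P setT (EFin \o pos) (cst 0).
  apply/ae_eq_integral_abs => //.
  move/eqP: qp_0; rewrite intqp mule_eq0 (negbTE c_neq0) orbF => /eqP <-.
  by apply: eq_integral => w _; rewrite gee0_abs// lee_fin.
have aeneg : ae_eq P setT (EFin \o neg) (cst 0).
  apply/ae_eq_integral_abs => //.
  move/eqP: qn_0; rewrite intqn mule_eq0 (negbTE c_neq0) orbF => /eqP <-.
  by apply: eq_integral => w _; rewrite gee0_abs// lee_fin.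
apply: filterS2 aepos aeneg => w /= /(_ I)[+] /(_ I)[].
rewrite /pos /neg subr0 sub0r.
by case: (leP (xi w) 0%R) => // _ _ /eqP; rewrite oppr_eq0 => /eqP.
Qed.

End rigidity.

(** * Telescoping sums of increments of a bounded function *)

Section telescoping.
Context {R : realType}.
Implicit Types (v : R -> R).

(** Only two values of v survive: v(x + k h) - v(x) for e = 1, and v(x + h) - v(x + h - k h) for e =
    -1. *)
Lemma sum_incr_le (h B : R) v (x e : R) (k : nat) : e = 1 \/ e = -1 ->
  (forall z, `|v z| <= B) ->
  `|\sum_(0 <= j < k) incr h v (x + e * (j%:R * h))| <= 2 * B.
Proof.
move=> e1 vB.
have vvB a b : `|v a - v b| <= 2 * B.
  by rewrite (le_trans (ler_normB _ _))// (_ : 2 * B = B + B) ?lerD//; ring.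
case: e1 => ->.
  under eq_bigr => j _.
    have -> : incr h v (x + 1 * (j%:R * h)) = v (x + j.+1%:R * h) - v (x + j%:R * h).
      by rewrite /incr -natr1; congr (v _ - v _); ring.
    over.
  by rewrite telescope_sumr.
under eq_bigr => j _.
  have -> : incr h v (x + -1 * (j%:R * h)) =
      - v (x + h - j.+1%:R * h) - (- v (x + h - j%:R * h)).
    by rewrite /incr -natr1 opprK addrC; congr (- v _ + v _); ring.
  over.
by rewrite (telescope_sumr (fun j => - v (x + h - j%:R * h)))// opprK addrC.
Qed.

(* Near-extremality of the increment at [x] propagates to the points
   x, x -/+ h, x -/+ 2h, ..., whose increments telescope; a bounded [v] does not
   allow this. *)
Lemma incr_lt_sup (k h a B S : R) v : k != 0 -> `|a| = 1 -> 0 < S ->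
  (forall x : R, derivable v x 1) -> (forall x, `|v x| <= B) ->
  (forall x, a * incr h v x <= S) ->
  (forall x, a * diffop k (incr h v) x <= S) ->
  exists2 eta, 0 < eta & forall x, a * incr h v x <= S - eta.
Proof.
move=> k0 a1 S0 dv vB zS AS.
(* m increments of size at least S/2 would sum to more than 2 B. *)
pose m := Num.bound (4 * B / S).
have B0 : 0 <= B by exact: le_trans (vB 0).
have mP : 4 * B < m%:R * S.
  by rewrite -ltr_pdivrMr//; apply: archi_boundP; rewrite divr_ge0 ?mulr_ge0// ltW.
pose K := expR (m%:R * `|k * h|).
have K0 : 0 < K by exact: expR_gt0.
(* K bounds the growth of the defect w = S - a ([incr h v]) over m steps, so a defect below S / (2
   K) at x stays below S / 2 throughout. *)
exists (S / (2 * K)) => [|x]; first by rewrite divr_gt0// mulr_gt0.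
pose w z := - a * incr h v z - (- S).
have dz (z : R) : derivable (incr h v) z 1 by case: (is_derive_incr h z dv).
have dw (z : R) : derivable w z 1 by exact: derivable_affine.
have Aw z : 0 <= diffop k w z.
  by rewrite diffop_affine//; have := AS z; lra.
have wle t : 0 <= t -> w (x - t / k) <= expR t * w x.
  by move=> t0; apply: diffop_ge0_le.
have wx0 : 0 <= w x by rewrite /w; have := zS x; lra.
rewrite leNgt; apply/negP => zx.
have wxK : K * w x < S / 2.
  have -> : S / 2 = K * (S / (2 * K)) by field; exact: lt0r_neq0.
  by rewrite ltr_pM2l// /w; lra.
(* The comparison moves only in the direction of -1/k; e records whether this makes the steps h or
   -h. *)
have [e [e1 ek]] : exists e, (e = 1 \/ e = -1) /\ - `|k * h| / k = e * h.
  have [kh|kh] := leP 0 (k * h).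
    by exists (-1); split; [right|rewrite ger0_norm//; field].
  by exists 1; split; [left|rewrite ltr0_norm//; field].
have zj j : (j <= m)%N -> S / 2 <= a * incr h v (x + e * (j%:R * h)).
  move=> jm.
  have -> : x + e * (j%:R * h) = x - (j%:R * `|k * h|) / k.
    by rewrite mulrCA -ek; field.
  have t0 : 0 <= j%:R * `|k * h| by rewrite mulr_ge0.
  have := wle _ t0.
  have : expR (j%:R * `|k * h|) * w x <= K * w x.
    by rewrite ler_wpM2r// ler_expR ler_wpM2r// ler_nat.
  by rewrite {3}/w; lra.
have : m%:R * (S / 2) <= 2 * B.
  have := sum_incr_le h x m e1 vB.
  have -> : forall z : R, `|z| = `|a * z| by move=> z; rewrite normrM a1 mul1r.
  rewrite mulr_sumr => H; apply: le_trans H.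
  apply: le_trans (ler_norm _).
  rewrite mulr_natl -[m in leLHS]subn0 -sumr_const_nat.
  by apply: ler_sum_nat => j /andP[_ jm]; exact: zj (ltnW jm).
lra.
Qed.

End telescoping.

(** * Bounds on the right-hand side and on its increments *)

Lemma probability_integral_cst (R : realType) d (T : measurableType d)
  (P : probability T R) (c : R) : (\int[P]_w c%:E = c%:E)%E.
Proof. by have := expectation_cst P c; rewrite expectation.unlock. Qed.

Section rhs_increments.
Context {R : realType} d (T : measurableType d) (P : probability T R).
Variables (alpha gamma : {RV P >-> R}) (y F : R -> R) (B : R).
Hypotheses (cy : continuous y) (yB : forall x, `|y x| <= B).
Hypothesis FE : forall x,
  ((F x)%:E = 'E_P[fun w => (y (alpha w * (x - gamma w)))%R])%E.

Let Y (x : R) (w : T) : R := y (alpha w * (x - gamma w)).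

Let mY x : measurable_fun setT (Y x).
Proof.
apply: measurableT_comp; first exact: continuous_measurable_fun.
by apply: measurable_funM => //; exact: measurable_funB.
Qed.

Let iY x : P.-integrable setT (EFin \o Y x).
Proof.
apply: measurable_bounded_integrable => //.
  by rewrite (@le_lt_trans _ _ 1%E) ?ltry ?probability_le1.
exists B; split; first exact: num_real.
by move=> M BM w _; exact: le_trans (yB _) (ltW BM).
Qed.

Lemma rhs_bound x : `|F x| <= B.
Proof.
rewrite -lee_fin -abse_EFin FE expectation.unlock.
apply: (@le_trans _ _ (\int[P]_w `|(Y x w)%:E|)%E).
  by apply: le_abse_integral => //; exact/measurable_EFinP/mY.
apply: (@le_trans _ _ (\int[P]_w B%:E)%E); last first.
  by rewrite probability_integral_cst.
apply: ge0_le_integral => //.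
- by apply/measurable_EFinP; apply: measurableT_comp => //; exact: mY.
- by move=> w _; rewrite abse_EFin lee_fin; exact: yB.
Qed.

(** Shifting x by h shifts the argument alpha (x - gamma) by alpha h. An almost sure bound is
    allowed for the sake of the case |alpha| = 1 almost surely. *)
Lemma rhs_incr_le (K : T -> R) (h x : R) : measurable_fun setT K ->
  (forall w, 0 <= K w) ->
  {ae P, forall w, forall z, `|incr (alpha w * h) y z| <= K w} ->
  (`|incr h F x|%:E <= \int[P]_w (K w)%:E)%E.
Proof.
move=> mK K0 yK.
rewrite -abse_EFin /incr EFinB !FE expectation.unlock.
have := @integralB_EFin _ _ _ P _ _ _ measurableT (iY (x + h)) (iY x).
rewrite /comp => <-.
apply: (@le_trans _ _ (\int[P]_w `|(Y (x + h) w - Y x w)%:E|)%E).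
  by apply: le_abse_integral => //; apply/measurable_EFinP; apply: measurable_funB; exact: mY.
apply: ae_ge0_le_integral => //.
- apply/measurable_EFinP; apply: measurableT_comp => //.
  apply: measurable_funB; exact: mY.
- by move=> w _; rewrite lee_fin.
- exact/measurable_EFinP.
apply: filterS yK => w /(_ (alpha w * (x - gamma w))) + _.
by rewrite lee_fin /incr /Y -mulrDr addrAC.
Qed.

End rhs_increments.

(** * The modulus of continuity on a logarithmic scale *)

Section modulus_of_continuity.
Context {R : realType}.
Variables (y : R -> R) (B Lam : R).

(** On this scale, replacing h by alpha h becomes the translation of t by ln|alpha|. *)
Definition modulus (t : R) : R :=
  sup [set z | exists h x, `|h| <= expR t /\ z = `|incr h y x|].

Hypothesis yB : forall x, `|y x| <= B.
Hypothesis yLip : forall h x, `|incr h y x| <= Lam * `|h|.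

Lemma modulus_le t C : (forall h x, `|h| <= expR t -> `|incr h y x| <= C) ->
  modulus t <= C.
Proof.
move=> yC; apply: ge_sup.
  by exists `|incr 0 y 0|, 0, 0; rewrite normr0 expR_ge0.
by move=> _ [h [x [ht ->]]]; exact: yC.
Qed.

Lemma incr_le_modulus t h x : `|h| <= expR t -> `|incr h y x| <= modulus t.
Proof.
move=> ht; apply: ub_le_sup; last by exists h, x.
exists (2 * B) => _ [k [z [_ ->]]].
by rewrite (le_trans (ler_normB _ _))// (_ : 2 * B = B + B) ?lerD//; ring.
Qed.

Lemma modulus_ge0 t : 0 <= modulus t.
Proof.
by apply: le_trans (@incr_le_modulus t 0 0 _); rewrite ?normr0 ?expR_ge0.
Qed.

Lemma modulus_bounded t : modulus t <= 2 * B.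
Proof.
apply: modulus_le => h x _.
by rewrite (le_trans (ler_normB _ _))// (_ : 2 * B = B + B) ?lerD//; ring.
Qed.

Lemma modulus_nd : {homo modulus : s t / s <= t}.
Proof.
move=> s t st; apply: modulus_le => h x hs; apply: incr_le_modulus.
by rewrite (le_trans hs)// ler_expR.
Qed.

Let Lam_ge0 : 0 <= Lam.
Proof. by have := le_trans (normr_ge0 _) (yLip 1 0); rewrite normr1 mulr1. Qed.

Lemma modulus_le_expR t : modulus t <= Lam * expR t.
Proof.
by apply: modulus_le => h x ht; rewrite (le_trans (yLip _ _))// ler_wpM2l.
Qed.

(** A step h with |h| > e^s is a step of length e^s in the same direction, then a remainder of
    length at most e^t - e^s, to which the Lipschitz bound applies. *)
Let modulus_incr_le s t : s <= t ->
  modulus t <= modulus s + Lam * (expR t - expR s).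
Proof.
move=> st; have est : expR s <= expR t by rewrite ler_expR.
apply: modulus_le => h x ht.
have [hs|hs] := leP `|h| (expR s).
  rewrite (le_trans (incr_le_modulus x hs))// lerDl mulr_ge0// subr_ge0//.
pose e := Num.sg h.
have e1 : `|e| = 1.
  by rewrite /e normr_sg; case: eqP hs => // ->; rewrite normr0 ltNge expR_ge0.
have -> : incr h y x = incr (h - e * expR s) y (x + e * expR s) +
    incr (e * expR s) y x.
  by rewrite /incr (_ : x + e * expR s + _ = x + h); ring.
rewrite (le_trans (ler_normD _ _))// addrC lerD//.
  by apply: incr_le_modulus; rewrite normrM e1 mul1r ger0_norm ?expR_ge0.
rewrite (le_trans (yLip _ _))// ler_wpM2l//.
rewrite {1}(numEsg h) -/e -mulrBr normrM e1 mul1r ger0_norm ?subr_ge0 ?(ltW hs)//.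
by rewrite lerB.
Qed.

Lemma modulus_continuous : continuous modulus.
Proof.
move=> t; apply/cvgrPdist_le => e e0.
have /cvgrPdist_le /(_ e e0) : (fun s => Lam * expR s) @ t --> Lam * expR t.
  by apply: cvgMr; exact: continuous_expR.
apply: filterS => s; apply: le_trans; rewrite -mulrBr.
have [st|/ltW st] := leP s t.
  rewrite !ger0_norm ?mulr_ge0 ?subr_ge0 ?ler_expR ?modulus_nd//.
  by rewrite lerBlDl modulus_incr_le.
rewrite distrC -[X in _ <= X]normrN -mulrN opprB.
rewrite !ger0_norm ?mulr_ge0 ?subr_ge0 ?ler_expR ?modulus_nd//.
by rewrite lerBlDl modulus_incr_le.
Qed.

Lemma modulus_cst_eq0 : (forall s t, modulus s = modulus t) ->
  forall x, y x = y 0.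
Proof.
move=> Mcst.
have M0 : modulus 0 = 0.
  apply/eqP; rewrite eq_le modulus_ge0 andbT leNgt; apply/negP => M0.
  have L1 : 0 < Lam + 1 by have := Lam_ge0; lra.
  (* At this scale the constant value M(0) is at most Lam M(0) / (Lam + 1) < M(0); Lam + 1 avoids a
     division by 0. *)
  have := modulus_le_expR (ln (modulus 0 / (Lam + 1))).
  rewrite lnK ?posrE ?divr_gt0// (Mcst _ 0) leNgt => /negP; apply.
  by rewrite mulrA ltr_pdivrMr// mulrC ltr_pM2l//; lra.
move=> x; apply/eqP; rewrite -subr_eq0 -normr_le0.
have := @incr_le_modulus `|x| x 0; rewrite (Mcst _ 0) M0 /incr add0r; apply.
by have := expR_ge1Dx `|x|; lra.
Qed.

End modulus_of_continuity.

(** * From the equation to the dichotomy, and the case |alpha| = 1 *)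

Theorem theorem3p8 (R : realType) (d : measure_display) (T : measurableType d)
    (P : probability T R) (r : nat) (kappa : 'I_r -> R)
    (alpha gamma : {RV P >-> R}) (y : R -> R) :
  (1 <= r)%N ->
  (forall j : 'I_r, kappa j != 0) ->
  P [set w | alpha w != 0] = 1%E ->
  expectation_well_defined P (fun w => ln `|alpha w|) ->
  ('E_P[fun w => ln `|alpha w|] <= 0)%E ->
  bounded_solution P kappa alpha gamma y ->
  exists c : R, forall x : R, y x = c.
Proof.
case: r kappa => [//|n] kappa _ k0 _ wd Exi [bdy dy FE].
have [B yB] : exists B, forall x, `|y x| <= B.
  case: bdy => B0 [_ HB]; exists (B0 + 1) => x.
  by apply: HB => //; rewrite ltrDl.
have dy1 (x : R) : derivable y x 1 by exact: (dy 0%N).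
have cy : continuous y.
  by move=> x; apply/differentiable_continuous/derivable1_diffP.
pose F := diffop_prod kappa y.
pose kappa' i := kappa (lift ord0 i).
have k'0 i : kappa' i != 0 by exact: k0.
have dy' : times_differentiable n y by exact: times_differentiableW dy.
pose v := diffop_prod kappa' y.
have dv (x : R) : derivable v x 1 by exact: derivable_diffop_prod.
have Fv : F = diffop (kappa ord0) v by rewrite /F diffop_prodS.
have FB x : `|F x| <= B := rhs_bound cy yB FE x.
have vB x : `|v x| <= B.
  apply: (@diffop_bound _ (kappa ord0)) => //; last by rewrite -Fv.
  move=> s s0 /escapes_diffop_prod esc.
  by apply: (@bounded_not_escapes R s B y yB); exact: esc.
have incr_yB h x : `|incr h y x| <= 2 * B.
  by rewrite (le_trans (ler_normB _ _))// (_ : 2 * B = B + B) ?lerD//; ring.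
have incr_le_v h C : (forall x, `|incr h v x| <= C) ->
    forall x, `|incr h y x| <= C.
  move=> vC; apply: (diffop_prod_bound k'0 _ (incr_yB h)).
    exact: times_differentiable_incr.
  by rewrite diffop_prod_incr.
(* The outermost factor gives v' = kappa_0 (F - v), where |F| and |v| are at most B. *)
pose Lam := `|kappa ord0| * (2 * B).
have v'B x : `|derive1 v x| <= Lam.
  have -> : derive1 v x = kappa ord0 * (F x - v x).
    by rewrite Fv /diffop; field.
  rewrite normrM ler_wpM2l// (le_trans (ler_normB _ _))//.
  by rewrite (_ : 2 * B = B + B) ?lerD//; ring.
have v_itv a b : a <= b -> `|v b - v a| <= Lam * (b - a).
  move=> ab; have [| |c _ ->] := @MVT_segment R v (derive1 v) a b ab.
  - by move=> z _; rewrite derive1E; exact/derivableP.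
  - by apply: derivable_within_continuous => z _.
  by rewrite normrM (ger0_norm (_ : 0 <= b - a)) ?subr_ge0// ler_wpM2r ?subr_ge0.
have vLip h x : `|incr h v x| <= Lam * `|h|.
  have [h0|h0] := leP 0 h.
    have := v_itv x (x + h); rewrite lerDl h0 (_ : x + h - x = h); last by ring.
    by rewrite (ger0_norm h0); apply.
  have := v_itv (x + h) x; rewrite gerDl (ltW h0) distrC.
  rewrite (_ : x - (x + h) = - h); last by ring.
  by rewrite (ltr0_norm h0); apply.
have yLip h x : `|incr h y x| <= Lam * `|h|.
  by apply: incr_le_v => z; exact: vLip.
pose M := modulus y.
pose xi w := ln `|alpha w|.
have mxi : measurable_fun setT xi.
  by apply: measurableT_comp => //; apply: measurableT_comp.
have alpha_le w : `|alpha w| <= expR (xi w).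
  (* ln 0 = 0, so [xi w = 0] where [alpha] vanishes. *)
  have [->|a0] := eqVneq (alpha w) 0; first by rewrite normr0 expR_ge0.
  by rewrite /xi lnK// posrE normr_gt0.
have mM : measurable_fun setT M.
  apply: continuous_measurable_fun; exact: (modulus_continuous yB yLip).
have mMxi t : measurable_fun setT (fun w => M (t + xi w)).
  by apply: measurableT_comp => //; exact: measurable_funD.
have M0 t : 0 <= M t by exact: modulus_ge0 yB _.
have subM t : ((M t)%:E <= \int[P]_w (M (t + xi w))%:E)%E.
  have : (0 <= \int[P]_w (M (t + xi w))%:E)%E.
    by apply: integral_ge0 => w _; rewrite lee_fin.
  have : (\int[P]_w (M (t + xi w))%:E <= (2 * B)%:E)%E.
    rewrite -[leRHS](probability_integral_cst P).
    apply: ge0_le_integral => //.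
    - by move=> w _; rewrite lee_fin.
    - exact/measurable_EFinP.
    - by move=> w _; rewrite lee_fin; exact: modulus_bounded.
  (* The mean is a real number C. For |h| <= e^t it bounds the increments of F, hence those of y by
     [diffop_prod_bound]. *)
  case I : (\int[P]_w _)%E => [C| |]//= _ _.
  rewrite lee_fin; apply: modulus_le => h x ht.
  apply: (diffop_prod_bound k0 _ (incr_yB h)).
    exact: times_differentiable_incr.
  move=> {}x; rewrite diffop_prod_incr// -lee_fin -I.
  apply: (rhs_incr_le cy yB FE) => //.
  apply: nearW => w z; apply: (incr_le_modulus yB).
  by rewrite normrM mulrC expRD ler_pM.
(* E xi^+ = +oo would force E xi^- < +oo by well-definedness, hence E xi = +oo. E xi^- may be
   infinite. *)
have [Efin Ele] : (\int[P]_w (EFin \o xi)^\+ w < +oo)%E /\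
    (\int[P]_w (EFin \o xi)^\+ w <= \int[P]_w (EFin \o xi)^\- w)%E.
  have : ((\int[P]_w (EFin \o xi)^\+ w) - (\int[P]_w (EFin \o xi)^\- w) <= 0)%E.
    by rewrite -integralE; move: Exi; rewrite expectation.unlock.
  have : (0 <= \int[P]_w (EFin \o xi)^\+ w)%E by exact: integral_ge0.
  have : (0 <= \int[P]_w (EFin \o xi)^\- w)%E by exact: integral_ge0.
  move: wd; rewrite /expectation_well_defined -/xi.
  case: (\int[P]_w (EFin \o xi)^\+ w)%E => [p| |];
    case: (\int[P]_w (EFin \o xi)^\- w)%E => [q| |] //= _ _ _.
  - by rewrite -EFinB !lee_fin ltry subr_le0.
  - by rewrite ltry leey.
have MB t : 0 <= M t <= 2 * B by rewrite M0 modulus_bounded.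
have [Mcst|xi0] := subharmonic_rigidity mxi (modulus_nd yB)
  (modulus_continuous yB yLip) MB subM Efin Ele.
  by exists (y 0); exact: (modulus_cst_eq0 yB yLip).
(* Now xi = 0 almost surely. Vanishing increments of v make those of y vanish, through [incr_le_v]
   with bound 0. *)
suff z0 h x : incr h v x = 0.
  exists (y 0) => x; apply/eqP; rewrite -subr_eq0 -normr_le0.
  have := @incr_le_v x 0 _ 0; rewrite /incr add0r; apply => z.
  by have := z0 x z; rewrite /incr => ->; rewrite normr0.
pose S := sup [set `|incr h v z| | z in setT].
have zS z : `|incr h v z| <= S.
  apply: ub_le_sup; last by exists z.
  by exists (Lam * `|h|) => _ [u _ <-].
have [S0|S0] := leP S 0.
  by apply/eqP; rewrite -normr_le0 (le_trans (zS x)).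
have yS z : `|incr h y z| <= S by exact: incr_le_v.
have FS z : `|incr h F z| <= S.
  rewrite -lee_fin -[leRHS](probability_integral_cst P).
  apply: (rhs_incr_le cy yB FE) => //; first by move=> _; exact: ltW.
  apply: filterS xi0 => w xiw u.
  (* xi = 0 leaves alpha = 0, where the increment is 0, and alpha = 1 or -1; the last one reverses
     the increment. *)
  have [->|a0] := eqVneq (alpha w) 0.
    by rewrite mul0r /incr addr0 subrr normr0 ltW.
  move/eqP: xiw; rewrite /xi ln_eq0 ?normr_gt0// eqr_norml ler01 andbT.
  case/orP => /eqP ->; first by rewrite mul1r.
  have := yS (u - h); rewrite /incr subrK mulN1r.
  by rewrite distrC.
have AS z : `|diffop (kappa ord0) (incr h v) z| <= S.
  by rewrite diffop_incr// -Fv.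
have [e1 e10 He1] : exists2 e, 0 < e & forall x, 1 * incr h v x <= S - e.
  apply: (@incr_lt_sup _ (kappa ord0) h 1 B S v) => //; first exact: normr1.
  - by move=> z; rewrite mul1r; exact: le_trans (ler_norm _) (zS z).
  - by move=> z; rewrite mul1r; exact: le_trans (ler_norm _) (AS z).
have [e2 e20 He2] : exists2 e, 0 < e & forall x, -1 * incr h v x <= S - e.
  apply: (@incr_lt_sup _ (kappa ord0) h (-1) B S v) => //; first exact: normrN1.
  - by move=> z; have := zS z; rewrite ler_norml => /andP[]; lra.
  - by move=> z; have := AS z; rewrite ler_norml => /andP[]; lra.
(* The gaps below S for both signs of the increment contradict the choice of S as a supremum. *)
have : S <= S - Num.min e1 e2.
  apply: ge_sup; first by exists `|incr h v 0|, 0.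
  move=> _ [z _ <-].
  have := He1 z; have := He2 z; rewrite mul1r mulN1r => h1 h2.
  by rewrite ler_norml; case: (leP e1 e2) => ?; apply/andP; split; lra.
by case: (leP e1 e2) => ?; lra.
Qed.
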